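(* Let $p,q,r$ be pairwise distinct primes with $p<q$ and $p<r$, and write $\Phi_{pqr}(x)=\sum_{n}a_{pqr}(n)x^n$. Put $A_+=\max_n a_{pqr}(n)$ and $A_-=\min_n a_{pqr}(n)$. Let $q',r'\in\{1,\dots,p-1\}$ be the inverses of $q$ and $r$ modulo $p$, let $\alpha=\min\{q',r',p-q',p-r'\}$, and let $\beta$ be the unique integer with $0<\beta<p$ and $\alpha\beta qr\equiv 1 \pmod p$. Then $$A_+\le \min\{2\alpha+\beta,\;p-\beta\},\qquad -A_-\le \min\{p+2\alpha-\beta,\;\beta\}.$$
   Context: $\Phi_{pqr}(x)=\prod_{0<k<pqr,\ \gcd(k,pqr)=1}(x-\zeta^k)$, where $\zeta$ is a primitive $pqr$-th root of unity, is the ternary cyclotomic polynomial; $a_{pqr}(n)$ denotes its coefficient of $x^n$ (zero for $n$ outside $[0,\deg\Phi_{pqr}]$). *)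

(* Defs.v *)
From HB Require Import structures.
From mathcomp Require Import all_boot all_order all_algebra all_field.
Set Implicit Arguments. Unset Strict Implicit. Unset Printing Implicit Defensive.
Import Order.TTheory GRing.Theory Num.Theory.
Local Open Scope ring_scope.

(* a_{pqr}(n): coefficient of x^n in the cyclotomic polynomial Phi_{pqr} (in Z[x]);
   MathComp's nth-with-default gives 0 outside [0, deg]. *)
Definition acoef (p q r n : nat) : int := ('Phi_(p * q * r))`_n.

(* A_+ = max_n a_{pqr}(n), A_- = min_n a_{pqr}(n), n ranging over all n
   (coefficients beyond the degree are 0, hence the initial value 0). *)
Definition Aplus (p q r : nat) : int :=
  \big[Num.max/0]_(n < size ('Phi_(p * q * r))) acoef p q r n.
Definition Aminus (p q r : nat) : int :=
  \big[Num.min/0]_(n < size ('Phi_(p * q * r))) acoef p q r n.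

(* Main.v *)
Require Import Defs.
From HB Require Import structures.
From mathcomp Require Import all_boot all_order all_algebra all_field.
From mathcomp Require Import zify ring.
Import Order.TTheory GRing.Theory Num.Theory.
Local Open Scope ring_scope.
Set Implicit Arguments. Unset Strict Implicit. Unset Printing Implicit Defensive.

(** Every integer [m] is uniquely [x qr + y pr + z pq - F pqr] with [0 <= x < p], [0 <= y < q],
    [0 <= z < r].  In the relevant range [F] is 0, 1 or 2, and [chi m = (F == 0)] is the
    coefficient of [t^m] in [(1-t^pqr) / ((1-t^pq)(1-t^qr)(1-t^pr))].  Hence [a_pqr(n)] is the sum
    over the [p] values [m = n, n-1, ..., n-p+1] of
    [chi m - chi (m-q) - chi (m-r) + chi (m-q-r)], and [x] takes each residue once in this window.
    Subtracting [q] shifts [x] by [r'] and leaves [y] alone, subtracting [r] shifts [x] by [q'] and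
    leaves [z] alone.  So the second difference of [F] depends on [x] only: it is -1 for [alpha]
    values of [x], 1 for [alpha] values, 0 elsewhere.  A summand equal to 1 occurs either at the
    former values, or at a second difference 0 with
    [(F m, F (m-q), F (m-r), F (m-q-r)) = (2, 1, 1, 0)] or [(0, 1, 1, 2)].  The latter confines [x]
    to [p - alpha - beta] values; it also confines [y/q] and [z/r] to intervals of lengths [beta/p]
    and [alpha/p], which with [F m] known leaves at most [alpha + beta] values of [x].  Summands
    equal to -1 are treated in the same way. *)

(** * Divisors, factors of [X^n - 1], and the ternary cyclotomic quotient *)

Lemma perm_divisors_pmul (p n : nat) : prime p -> ~~ (p %| n)%N -> (0 < n)%N ->
  perm_eq (divisors (p * n)) (divisors n ++ [seq (p * d)%N | d <- divisors n]).
Proof.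
move=> p_pr pNn n_gt0; have p_gt0 := prime_gt0 p_pr.
apply: uniq_perm; first exact: divisors_uniq.
  rewrite cat_uniq divisors_uniq map_inj_uniq ?divisors_uniq ?andbT /=; last first.
    by move=> a b /eqP; rewrite eqn_pmul2l // => /eqP.
  apply/hasPn => _ /mapP[d _ ->]; rewrite -dvdn_divisors //.
  by apply: contra pNn; apply: dvdn_trans; apply: dvdn_mulr.
move=> d; rewrite mem_cat -!dvdn_divisors ?muln_gt0 ?p_gt0 //.
apply/idP/orP => [dpn | [dn | /mapP[e]]]; last 2 first.
- exact: dvdn_mull.
- by rewrite -dvdn_divisors // => en ->; rewrite dvdn_pmul2l.
have [/dvdnP[e de] | pNd] := boolP (p %| d)%N.
  right; apply/mapP; exists e; last by rewrite de mulnC.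
  by rewrite -dvdn_divisors // -(dvdn_pmul2l p_gt0) mulnC -de.
by left; rewrite -(@Gauss_dvdr _ p) // coprime_sym prime_coprime.
Qed.

Lemma Xn_sub1_pmul (p n : nat) : prime p -> ~~ (p %| n)%N -> (0 < n)%N ->
  'X^(p * n) - 1 = ('X^n - 1) * \prod_(d <- divisors n) 'Phi_(p * d) :> {poly int}.
Proof.
move=> p_pr pNn n_gt0.
have pn_gt0 : (0 < p * n)%N by rewrite muln_gt0 prime_gt0.
rewrite -(prod_Cyclotomic n_gt0) -(prod_Cyclotomic pn_gt0).
by rewrite (perm_big _ (perm_divisors_pmul p_pr pNn n_gt0)) big_cat big_map.
Qed.

Lemma perm_divisors_prime (p : nat) : prime p -> perm_eq (divisors p) [:: 1%N; p].
Proof.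
move=> p_pr; rewrite -[X in divisors X](muln1 p).
by apply: (perm_trans (perm_divisors_pmul p_pr _ _)) => //=; rewrite ?Euclid_dvd1 ?muln1.
Qed.

(** Splitting off one prime at a time turns both sides into products of the same ['Phi_d]; this is
    Möbius inversion cleared of denominators. *)
Lemma Cyclotomic_ternary (p q r : nat) :
  prime p -> prime q -> prime r -> p != q -> p != r -> q != r ->
  'Phi_(p * q * r) * (('X^(p * q) - 1) * ('X^(q * r) - 1) * ('X^(p * r) - 1) * ('X - 1))
  = ('X^(p * q * r) - 1) * (('X^p - 1) * ('X^q - 1) * ('X^r - 1)) :> {poly int}.
Proof.
move=> p_pr q_pr r_pr pq pr qr.
have [[p0 q0] r0] := (prime_gt0 p_pr, prime_gt0 q_pr, prime_gt0 r_pr).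
have pNq : ~~ (p %| q)%N by rewrite dvdn_prime2.
have pNr : ~~ (p %| r)%N by rewrite dvdn_prime2.
have qNr : ~~ (q %| r)%N by rewrite dvdn_prime2.
have pNqr : ~~ (p %| q * r)%N by rewrite Euclid_dvdM // negb_or pNq.
have pN1 : ~~ (p %| 1)%N by rewrite Euclid_dvd1.
rewrite -mulnA (Xn_sub1_pmul p_pr pNqr) ?muln_gt0 ?q0 //.
rewrite (perm_big _ (perm_divisors_pmul q_pr qNr r0)) big_cat big_map /=.
rewrite !(perm_big _ (perm_divisors_prime r_pr)) /= !big_cons !big_nil !muln1 !mulr1.
rewrite (Xn_sub1_pmul p_pr pNq q0) (Xn_sub1_pmul p_pr pNr r0).
have pE := Xn_sub1_pmul p_pr pN1 isT; rewrite muln1 in pE; rewrite {}pE.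
rewrite !(perm_big _ (perm_divisors_prime q_pr)) !(perm_big _ (perm_divisors_prime r_pr)).
rewrite /= !big_cons !big_nil !muln1 !mulr1 expr1; ring.
Qed.

(** * Coefficients of ['Phi_(p * q * r)] as sums over a lattice box *)

(** Integer indices are allowed because the window and its shifts by [q] and [r] can reach below
    zero. *)
Definition coefz (P : {poly int}) (m : int) : int := if m is Posz k then P`_k else 0.

Lemma coefMXn_coefz (P : {poly int}) (k n : nat) :
  (P * 'X^k)`_n = coefz P (n%:Z - k%:Z).
Proof.
rewrite coefMXn; case: ltnP => [nk | kn].
  by case E: (n%:Z - k%:Z) => [j|j] //; lia.
by rewrite subzn.
Qed.

(** This is [(X^(pqr) - 1)^3] divided by the three binomials with exponents [pq], [qr], [pr],
    expanded so that its coefficients count points of a box. *)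
Definition lattice_poly (p q r : nat) : {poly int} :=
  \sum_(t : 'I_p * 'I_q * 'I_r) 'X^(t.1.1 * (q * r) + t.1.2 * (p * r) + t.2 * (p * q)).

Lemma lattice_polyE (p q r : nat) :
  lattice_poly p q r = (\sum_(i < p) ('X^(q * r)) ^+ i) * (\sum_(i < q) ('X^(p * r)) ^+ i)
     * (\sum_(i < r) ('X^(p * q)) ^+ i).
Proof.
rewrite /lattice_poly big_distrlr /= pair_bigA big_distrlr /= pair_bigA /=.
apply: eq_bigr => -[[i j] k] _ /=.
by rewrite !exprD ![(_ * (_ * _))%N]mulnC !exprM.
Qed.

Lemma lattice_poly_mul (p q r : nat) :
  lattice_poly p q r * (('X^(p * q) - 1) * ('X^(q * r) - 1) * ('X^(p * r) - 1))
  = ('X^(p * q * r) - 1) ^+ 3.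
Proof.
have geom k m : ('X^k - 1) * (\sum_(i < m) ('X^k) ^+ i) = 'X^(k * m) - 1 :> {poly int}.
  by rewrite -subrX1 exprM.
have e1 := geom (p * q)%N r; have e2 := geom (q * r)%N p; have e3 := geom (p * r)%N q.
rewrite lattice_polyE; move: e1 e2 e3.
have -> : (q * r * p = p * q * r)%N by lia.
have -> : (p * r * q = p * q * r)%N by lia.
move=> e1 e2 e3; rewrite exprS expr2 -{1}e1 -{1}e2 -e3; ring.
Qed.

Lemma Xn_sub1_neq0 (n : nat) : (0 < n)%N -> 'X^n - 1 != 0 :> {poly int}.
Proof. by move=> n0; rewrite -size_poly_gt0 size_XnsubC. Qed.

Lemma Cyclotomic_lattice (p q r : nat) :
  prime p -> prime q -> prime r -> p != q -> p != r -> q != r ->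
  'Phi_(p * q * r) * ('X^(p * q * r) - 1) ^+ 2
  = lattice_poly p q r * (\sum_(i < p) 'X^i) * ('X^q - 1) * ('X^r - 1).
Proof.
move=> p_pr q_pr r_pr pq pr qr.
have [[p0 q0] r0] := (prime_gt0 p_pr, prime_gt0 q_pr, prime_gt0 r_pr).
have X1 : 'X - 1 != 0 :> {poly int} by rewrite -(expr1 'X) Xn_sub1_neq0.
have nz : ('X^(p * q) - 1) * ('X^(q * r) - 1) * ('X^(p * r) - 1) * ('X - 1) != 0 :> {poly int}.
  by rewrite !mulf_neq0 ?Xn_sub1_neq0 ?muln_gt0 ?p0 ?q0.
apply: (mulIf nz).
have E1 := Cyclotomic_ternary p_pr q_pr r_pr pq pr qr.
have E2 := lattice_poly_mul p q r.
have E3 := subrX1 ('X : {poly int}) p.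
transitivity ('Phi_(p * q * r) *
    (('X^(p * q) - 1) * ('X^(q * r) - 1) * ('X^(p * r) - 1) * ('X - 1))
    * ('X^(p * q * r) - 1) ^+ 2).
  by ring.
rewrite E1 E3.
transitivity (('X^(p * q * r) - 1) ^+ 3 *
    (('X - 1) * (\sum_(i < p) 'X^i) * ('X^q - 1) * ('X^r - 1) : {poly int})).
  by ring.
rewrite -E2; ring.
Qed.

Definition chi (p q r : nat) : int -> int := coefz (lattice_poly p q r).

Lemma Cyclotomic_ternary_coef (p q r n : nat) :
  prime p -> prime q -> prime r -> p != q -> p != r -> q != r -> (n < p * q * r)%N ->
  ('Phi_(p * q * r))`_n = \sum_(i < p)
    (chi p q r (n%:Z - i%:Z) - chi p q r (n%:Z - i%:Z - q%:Z)
     - chi p q r (n%:Z - i%:Z - r%:Z) + chi p q r (n%:Z - i%:Z - q%:Z - r%:Z)).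
Proof.
move=> p_pr q_pr r_pr pq pr qr nN.
have := congr1 (fun P : {poly int} => P`_n) (Cyclotomic_lattice p_pr q_pr r_pr pq pr qr).
(* The factor [(X^(pqr) - 1)^2] is 1 plus a multiple of [X^(pqr)], hence invisible below [pqr]. *)
rewrite (_ : 'Phi_(p * q * r) * ('X^(p * q * r) - 1) ^+ 2 =
  'Phi_(p * q * r) + ('Phi_(p * q * r) * ('X^(p * q * r) - 1 - 1)) * 'X^(p * q * r)); last by ring.
rewrite coefD coefMXn nN addr0 => ->.
rewrite mulr_sumr !mulr_suml coef_sum; apply: eq_bigr => i _.
rewrite (_ : lattice_poly p q r * 'X^i * ('X^q - 1) * ('X^r - 1) =
  lattice_poly p q r * 'X^i - lattice_poly p q r * 'X^(i + q)
  - lattice_poly p q r * 'X^(i + r) + lattice_poly p q r * 'X^(i + q + r)); last first.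
  rewrite !exprD; ring.
rewrite !(coefD, coefN) !coefMXn_coefz -!/(chi p q r _) !PoszD.
by rewrite !opprD !addrA.
Qed.

(** * Coordinates of an integer with respect to [p], [q], [r] *)

(* Writing m/pqr = x/p + y/q + z/r - F, the integer F measures how far m is from being a
   nonnegative combination of qr, rp, pq. *)
Definition crt_rep (p q r : nat) (m x y z F : int) : Prop :=
  [/\ 0 <= x < p%:Z, 0 <= y < q%:Z, 0 <= z < r%:Z &
      m = x * (q%:Z * r%:Z) + y * (p%:Z * r%:Z) + z * (p%:Z * q%:Z) - F * (p%:Z * q%:Z * r%:Z)].

Lemma modz_eq_small (p : nat) (x y : int) :
  0 <= x < p%:Z -> 0 <= y < p%:Z -> (p %| x - y)%Z -> x = y.
Proof.
move=> hx hy /dvdzP[k e].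
have k0 : k = 0 by nia.
by rewrite k0 mul0r in e; lia.
Qed.

Lemma coprimez_mul_dvd (p q r : nat) (x : int) :
  coprime p q -> coprime p r -> (p %| x * (q%:Z * r%:Z))%Z -> (p %| x)%Z.
Proof.
by move=> cq cr; rewrite Gauss_dvdzl // coprimezMr /coprimez /gcdz !absz_nat; apply/andP.
Qed.

(** Modulo [p] only the term [x qr] survives, and [qr] is invertible there. Permuting the primes
    gives the same for [y] and [z]. *)
Lemma crt_rep_eqx (p q r : nat) (m m' x y z F x' y' z' F' : int) :
  coprime p q -> coprime p r ->
  crt_rep p q r m x y z F -> crt_rep p q r m' x' y' z' F' -> (p %| m - m')%Z -> x = x'.
Proof.
move=> pq pr [hx _ _ ->] [hx' _ _ ->] /dvdzP[k e].
apply: modz_eq_small hx hx' _; apply: (coprimez_mul_dvd pq pr).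
apply/dvdzP; exists (k - (y - y') * r%:Z - (z - z') * q%:Z + (F - F') * (q%:Z * r%:Z)).
by rewrite !mulrDl mulNr -e; ring.
Qed.

Lemma crt_rep_perm1 (p q r : nat) (m x y z F : int) :
  crt_rep p q r m x y z F -> crt_rep q p r m y x z F.
Proof. by move=> [? ? ? ->]; split=> //; ring. Qed.

Lemma crt_rep_perm2 (p q r : nat) (m x y z F : int) :
  crt_rep p q r m x y z F -> crt_rep p r q m x z y F.
Proof. by move=> [? ? ? ->]; split=> //; ring. Qed.

Lemma crt_rep_uniq (p q r : nat) (m x y z F x' y' z' F' : int) :
  coprime p q -> coprime p r -> coprime q r ->
  crt_rep p q r m x y z F -> crt_rep p q r m x' y' z' F' ->
  [/\ x = x', y = y', z = z' & F = F'].
Proof.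
move=> pq pr qr h h'.
have ex : x = x' by apply: (crt_rep_eqx pq pr h h'); rewrite subrr dvdz0.
have ey : y = y'.
  apply: (crt_rep_eqx _ qr (crt_rep_perm1 h) (crt_rep_perm1 h')); first by rewrite coprime_sym.
  by rewrite subrr dvdz0.
have ez : z = z'.
  apply: (crt_rep_eqx _ _ (crt_rep_perm1 (crt_rep_perm2 h)) (crt_rep_perm1 (crt_rep_perm2 h'))).
  - by rewrite coprime_sym.
  - by rewrite coprime_sym.
  - by rewrite subrr dvdz0.
split=> //; case: h h' => [hx hy hz e] [_ _ _ e'].
move: e'; rewrite e -ex -ey -ez => /addrI /oppr_inj /mulIf; apply.
by rewrite !mulf_neq0 //; lia.
Qed.

Lemma crt_rep_ex (p q r : nat) (m : int) :
  (0 < p)%N -> (0 < q)%N -> (0 < r)%N -> coprime p q -> coprime p r -> coprime q r ->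
  exists x y z F, crt_rep p q r m x y z F.
Proof.
move=> p0 q0 r0 pq pr qr.
have bez a b : coprime a b -> exists s t : int, s * a%:Z + t * b%:Z = 1.
  move=> cab; have [s [t e]] := Bezoutz a b; exists s, t; rewrite e /gcdz !absz_nat.
  by rewrite (eqP cab).
have [a [b e1]] := bez _ _ pq; have [c [d e2]] := bez _ _ pr; have [e [f e3]] := bez _ _ qr.
(* The coordinates come from expanding [(a p + b q)(c p + d r) = 1]; the stray term [a c p^2] is
   distributed by means of [e q + f r = 1]. *)
pose A := m * b * d.
pose B := m * (a * d + a * c * p%:Z * f).
pose C := m * (b * c + a * c * p%:Z * e).
have mE : m = A * (q%:Z * r%:Z) + B * (p%:Z * r%:Z) + C * (p%:Z * q%:Z).
  have -> : A * (q%:Z * r%:Z) + B * (p%:Z * r%:Z) + C * (p%:Z * q%:Z) =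
    m * (b * d * (q%:Z * r%:Z) + a * d * (p%:Z * r%:Z) + b * c * (p%:Z * q%:Z)
         + a * c * p%:Z * p%:Z * (e * q%:Z + f * r%:Z)) by rewrite /A /B /C; ring.
  rewrite e3 -{1}[m]mulr1; congr (m * _).
  transitivity ((a * p%:Z + b * q%:Z) * (c * p%:Z + d * r%:Z)); first by rewrite e1 e2 mulr1.
  ring.
exists (A %% p)%Z, (B %% q)%Z, (C %% r)%Z, (- ((A %/ p)%Z + (B %/ q)%Z + (C %/ r)%Z)).
split; rewrite ?modz_ge0 ?ltz_pmod //; lia.
Qed.

(** A box point giving [m] is a representation with [F = 0], so uniqueness leaves at most one. *)
Lemma chi_crt_rep (p q r : nat) (m x y z F : int) :
  coprime p q -> coprime p r -> coprime q r ->
  crt_rep p q r m x y z F -> chi p q r m = (F == 0)%:R.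
Proof.
move=> pq pr qr h.
have noF (t : 'I_p * 'I_q * 'I_r) : 
  m = (t.1.1 * (q * r) + t.1.2 * (p * r) + t.2 * (p * q))%N ->
  [/\ x = t.1.1, y = t.1.2, z = t.2 & F = 0].
  move=> e; apply: (crt_rep_uniq pq pr qr h); case: t e => -[[i hi] [j hj]] [k hk] /= e.
  by split; rewrite ?e //; lia.
have [F0 | FN] := eqVneq F 0; last first.
  rewrite /chi; case: m h noF => // k h noF; rewrite /coefz /lattice_poly coef_sum big1 // => t _.
  rewrite coefXn; case: eqP => // e.
  by have [|_ _ _ F0] := noF t; [rewrite e | rewrite F0 eqxx in FN].
case: (h) => hx hy hz; rewrite F0 mul0r subr0.
case: x hx h noF => // x hx h noF; case: y hy h noF => // y hy h noF.
case: z hz h noF => // z hz h noF mE.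
pose t := (Ordinal (hx : x < p)%N, Ordinal (hy : y < q)%N, Ordinal (hz : z < r)%N).
have mE' : m = (t.1.1 * (q * r) + t.1.2 * (p * r) + t.2 * (p * q))%N by rewrite mE /=; lia.
rewrite mE' /chi /coefz /lattice_poly coef_sum (bigD1 t) //= coefXn eqxx big1 ?addr0 // => s st.
rewrite coefXn; case: eqP => // e.
have [|ex ey ez _] := noF s; first by rewrite mE' -e.
case/eqP: st; case: s ex ey ez {e} => -[s1 s2] s3 /= [ex] [ey] [ez].
by congr (_, _, _); apply: val_inj.
Qed.

(** * Counting through the spread of an injective integer function *)

(** Distances to the minimum of [f] on [S] are distinct naturals below [K]. *)
Lemma card_spread (T : finType) (S : {pred T}) (f : T -> int) (K : int) :
  0 <= K -> injective f ->
  (forall i j, i \in S -> j \in S -> f i - f j < K) -> #|S|%:Z <= K.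
Proof.
case: K => // K _ f_inj spread; rewrite lez_nat.
have [i1 i1S | S0] := pickP [in S]; last by rewrite eq_card0.
have [i0 i0S i0_min] := arg_minP f i1S.
pose g i := `|f i - f i0|%N.
have gE i : i \in S -> f i = f i0 + (g i)%:Z by move=> /i0_min; rewrite /g; lia.
have g_inj : {in S &, injective g}.
  by move=> i j iS jS gij; apply: f_inj; rewrite (gE i) // (gE j) // gij.
rewrite -(size_iota 0 K) cardE -(size_map g); apply: uniq_leq_size.
  rewrite map_inj_in_uniq ?enum_uniq // => i j; rewrite !mem_enum; exact: g_inj.
move=> _ /mapP[i iS ->]; rewrite mem_enum in iS.
by have := spread _ _ iS i0S; rewrite mem_iota (gE i) //; lia.
Qed.

(** In the applications [f] is the coordinate [x], [P1] holds where the second difference of [F] is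
    nonzero, and [P2] describes the exceptional summands. *)
Lemma sum_le_spread (T : finType) (t f : T -> int) (P1 P2 : pred T) (K1 K2 : int) :
  injective f -> 0 <= K1 -> 0 <= K2 ->
  (forall i, t i <= (P1 i)%:R + (P2 i)%:R) ->
  (forall i j, P1 i -> P1 j -> f i - f j < K1) ->
  (forall i j, P2 i -> P2 j -> f i - f j < K2) ->
  \sum_i t i <= K1 + K2.
Proof.
move=> f_inj K1_ge0 K2_ge0 tP spread1 spread2.
apply: le_trans (ler_sum _ (fun i _ => tP i)) _.
have sumP (P : pred T) : \sum_i (P i)%:R = #|P|%:Z.
  by rewrite -natr_sum natz -sum1_card [in RHS]big_mkcond.
rewrite big_split /= !sumP lerD //.
  exact: card_spread f_inj spread1.
exact: card_spread f_inj spread2.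
Qed.

(** * Range of [F] and its change under shifts by [q] and [r] *)

Lemma crt_rep_F_ge0 (p q r : nat) (m x y z F : int) :
  crt_rep p q r m x y z F -> m < p%:Z * q%:Z * r%:Z -> 0 <= F.
Proof.
move=> [/andP[x0 _] /andP[y0 _] /andP[z0 _] ->] mN.
have : 0 <= x * (q%:Z * r%:Z) + y * (p%:Z * r%:Z) + z * (p%:Z * q%:Z).
  by rewrite !addr_ge0 ?mulr_ge0.
have : 0 <= p%:Z * q%:Z * r%:Z by rewrite !mulr_ge0.
by nia.
Qed.

Lemma crt_rep_F_le2 (p q r : nat) (m x y z F : int) :
  crt_rep p q r m x y z F ->
  - (q%:Z * r%:Z + p%:Z * r%:Z + p%:Z * q%:Z) < m -> F <= 2.
Proof.
move=> [/andP[_ xp] /andP[_ yq] /andP[_ zr] ->] mN.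
have hx : x * (q%:Z * r%:Z) <= (p%:Z - 1) * (q%:Z * r%:Z) by rewrite ler_wpM2r ?mulr_ge0 //; lia.
have hy : y * (p%:Z * r%:Z) <= (q%:Z - 1) * (p%:Z * r%:Z) by rewrite ler_wpM2r ?mulr_ge0 //; lia.
have hz : z * (p%:Z * q%:Z) <= (r%:Z - 1) * (p%:Z * q%:Z) by rewrite ler_wpM2r ?mulr_ge0 //; lia.
have N0 : 0 <= p%:Z * q%:Z * r%:Z by rewrite !mulr_ge0.
have : F * (p%:Z * q%:Z * r%:Z) < 3 * (p%:Z * q%:Z * r%:Z) by lia.
by nia.
Qed.

(** Multiplied by [q], the relation between [u] and [w] reads [q = u qr + w pq - pqr]. Each borrow,
    by [p] in [x] or by [r] in [z], raises [F] by 1. *)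
Lemma crt_rep_subq (p q r : nat) (u w m x y z F : int) :
  0 <= u <= p%:Z -> 0 <= w <= r%:Z -> u * r%:Z + w * p%:Z = p%:Z * r%:Z + 1 ->
  crt_rep p q r m x y z F ->
  crt_rep p q r (m - q%:Z) (x - u + (if x < u then p%:Z else 0)) y
    (z - w + (if z < w then r%:Z else 0))
    (F - 1 + (if x < u then 1 else 0) + (if z < w then 1 else 0)).
Proof.
move=> hu hw e [hx hy hz ->]; split=> //.
- by case: ltrP => ?; lia.
- by case: ltrP => ?; lia.
have eq' := congr1 ( *%R q%:Z) e.
by case: (x < u); case: (z < w); lia.
Qed.

Lemma crt_rep_subr (p q r : nat) (v w m x y z F : int) :
  0 <= v <= p%:Z -> 0 <= w <= q%:Z -> v * q%:Z + w * p%:Z = p%:Z * q%:Z + 1 ->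
  crt_rep p q r m x y z F ->
  crt_rep p q r (m - r%:Z) (x - v + (if x < v then p%:Z else 0))
    (y - w + (if y < w then q%:Z else 0)) z
    (F - 1 + (if x < v then 1 else 0) + (if y < w then 1 else 0)).
Proof.
move=> hv hw e /crt_rep_perm2 h; apply: crt_rep_perm2.
exact: crt_rep_subq hv hw e h.
Qed.

(** With equal [F], [(x - x') qr] equals [(m - m') + (y' - y) pr + (z' - z) pq]. The slack [p - 1]
    in the bounds on [y] and [z] outweighs [m - m'], as [(p - 1)(q + r - 1) > 0]. *)
Lemma crt_rep_spread (p q r : nat) (U V m m' x y z F x' y' z' : int) :
  (1 < p)%N -> (0 < q)%N -> (0 < r)%N ->
  crt_rep p q r m x y z F -> crt_rep p q r m' x' y' z' F -> m - m' <= p%:Z - 1 ->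
  (y' - y) * p%:Z <= V * q%:Z - (p%:Z - 1) -> (z' - z) * p%:Z <= U * r%:Z - (p%:Z - 1) ->
  x - x' < U + V.
Proof.
move=> p1 q0 r0 [_ _ _ ->] [_ _ _ ->] mm hy hz.
have qr0 : 0 < q%:Z * r%:Z by rewrite mulr_gt0 //; lia.
rewrite -(ltr_pM2r qr0).
have hy' := ler_wpM2r (isT : 0 <= r%:Z) hy.
have hz' := ler_wpM2r (isT : 0 <= q%:Z) hz.
have hp : 0 <= (p%:Z - 1) * (q%:Z - 1) by rewrite mulr_ge0 //; lia.
have hp' : 0 < (p%:Z - 1) * r%:Z by rewrite mulr_gt0 //; lia.
by lia.
Qed.

(** * A single summand, classified by the coordinate [x] *)

Definition chi_diff (p q r : nat) (m : int) : int :=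
  chi p q r m - chi p q r (m - q%:Z) - chi p q r (m - r%:Z) + chi p q r (m - q%:Z - r%:Z).

Section Local.
Variables (p q r : nat) (u v w w' : int).
Hypotheses (pq : coprime p q) (pr : coprime p r) (qr : coprime q r).
Hypotheses (hu : 0 <= u <= p%:Z) (hv : 0 <= v <= p%:Z).
Hypotheses (hw : 0 <= w <= r%:Z) (hw' : 0 <= w' <= q%:Z).
Hypotheses (uw : u * r%:Z + w * p%:Z = p%:Z * r%:Z + 1).
Hypotheses (vw : v * q%:Z + w' * p%:Z = p%:Z * q%:Z + 1).
Variables (m x y z F : int).
Hypotheses (m_lt : m < p%:Z * q%:Z * r%:Z)
  (m_gt : - (q%:Z * r%:Z + p%:Z * r%:Z + p%:Z * q%:Z) < m - q%:Z - r%:Z).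
Hypothesis rep : crt_rep p q r m x y z F.

(** Here [b], [c], [d] are the values of [F] at [m - q], [m - r], [m - q - r]. Subtracting [r] keeps
    [z], so the test [z < w] enters both [b] and [d] and cancels in [F - b - c + d]. *)
Lemma chi_diffE : exists b c d : int,
  [/\ chi_diff p q r m = (F == 0)%:R - (b == 0)%:R - (c == 0)%:R + (d == 0)%:R,
   [&& 0 <= F <= 2, 0 <= b <= 2, 0 <= c <= 2 & 0 <= d <= 2],
   b = F - 1 + (if x < u then 1 else 0) + (if z < w then 1 else 0),
   c = F - 1 + (if x < v then 1 else 0) + (if y < w' then 1 else 0) &
   d = c - 1 + (if x - v + (if x < v then p%:Z else 0) < u then 1 else 0)
       + (if z < w then 1 else 0)].
Proof.
have repq := crt_rep_subq hu hw uw rep.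
have repr := crt_rep_subr hv hw' vw rep.
have repqr := crt_rep_subq hu hw uw repr.
rewrite [m - r%:Z - q%:Z]addrAC in repqr.
eexists; eexists; eexists; split; [| |reflexivity|reflexivity|reflexivity].
  rewrite /chi_diff (chi_crt_rep pq pr qr rep) (chi_crt_rep pq pr qr repq).
  by rewrite (chi_crt_rep pq pr qr repr) (chi_crt_rep pq pr qr repqr).
have range m' x' y' z' F' : crt_rep p q r m' x' y' z' F' -> m - q%:Z - r%:Z <= m' <= m ->
    0 <= F' <= 2.
  move=> rep' /andP[lo hi]; rewrite (crt_rep_F_ge0 rep') ?(crt_rep_F_le2 rep') //.
    exact: lt_le_trans m_gt lo.
  exact: le_lt_trans hi m_lt.
apply/and4P; split.
- by apply: range rep _; lia.
- by apply: range repq _; lia.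
- by apply: range repr _; lia.
- by apply: range repqr _; lia.
Qed.

Let hx : 0 <= x < p%:Z. Proof. by case: rep. Qed.

Ltac chi_cases := have [b [c [d []]]] := chi_diffE; rewrite !natz => -> ?;
  case: (ltrP z w) => ?; case: (ltrP y w') => ?; case: (ltrP x u) => ?; case: (ltrP x v) => ?;
  case: (ltrP (_ + _) u) => ?; lia.

(** The second difference is -1 on [[0, u)] and 1 on [[v, u + v)]. The exceptional term is the
    pattern [(F, b, c, d) = (2, 1, 1, 0)]. *)
Lemma chi_diff_le_small : 0 < u <= v -> u + v <= p%:Z ->
  chi_diff p q r m <= (0 <= x < u)%R%:R
    + [&& (u + v <= x < p%:Z)%R, (F == 2)%R, (w' <= y)%R & (w <= z)%R]%:R.
Proof. by move=> h1 h2; chi_cases. Qed.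

(** The exceptional pattern is [(1, 0, 2, 1)]. *)
Lemma chi_diff_ge_small : 0 < u <= v -> u + v <= p%:Z ->
  - chi_diff p q r m <= (v <= x < u + v)%R%:R
    + [&& (u <= x < v)%R, (F == 1)%R, (y < w')%R & (w <= z)%R]%:R.
Proof. by move=> h1 h2; chi_cases. Qed.

(** The second difference is now -1 on [[u + v - p, v)] and 1 on [[u, p)]; the exceptional pattern
    is [(0, 1, 1, 2)]. *)
Lemma chi_diff_le_large : v <= u < p%:Z -> p%:Z <= u + v ->
  chi_diff p q r m <= (u + v - p%:Z <= x < v)%R%:R
    + [&& (0 <= x < u + v - p%:Z)%R, (F == 0)%R, (y < w')%R & (z < w)%R]%:R.
Proof. by move=> h1 h2; chi_cases. Qed.

(** The exceptional pattern is [(1, 2, 0, 1)]. *)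
Lemma chi_diff_ge_large : v <= u < p%:Z -> p%:Z <= u + v ->
  - chi_diff p q r m <= (u <= x < p%:Z)%R%:R
    + [&& (v <= x < u)%R, (F == 1)%R, (w' <= y)%R & (z < w)%R]%:R.
Proof. by move=> h1 h2; chi_cases. Qed.

End Local.

(** * Summation over a window of [p] consecutive integers *)

Lemma crt_rep_window (p q r n : nat) :
  (0 < p)%N -> (0 < q)%N -> (0 < r)%N -> coprime p q -> coprime p r -> coprime q r ->
  exists x y z F : 'I_p -> int,
    injective x /\ forall i : 'I_p, crt_rep p q r (n%:Z - i%:Z) (x i) (y i) (z i) (F i).
Proof.
move=> p0 q0 r0 pq pr qr.
have /fin_all_exists[x] := fun i : 'I_p => crt_rep_ex (n%:Z - i%:Z) p0 q0 r0 pq pr qr.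
move=> /fin_all_exists[y] /fin_all_exists[z] /fin_all_exists[F] rep.
exists x, y, z, F; split=> // i j xij; apply: val_inj; apply/eqP; rewrite -eqz_nat; apply/eqP.
have [_ _ _ ei] := rep i; have [_ _ _ ej] := rep j.
apply: (@modz_eq_small p); rewrite ?lez_nat ?ltz_nat ?leq0n ?ltn_ord //.
apply/dvdzP; exists ((y j - y i) * r%:Z + (z j - z i) * q%:Z - (F j - F i) * (q%:Z * r%:Z)).
have -> : i%:Z - j%:Z = (n%:Z - j%:Z) - (n%:Z - i%:Z) by ring.
by rewrite ei ej xij; ring.
Qed.

Lemma modn_inv_complement (p r u : nat) : (1 < p)%N -> (u <= p)%N -> (u * r = 1 %[mod p])%N ->
  exists2 w : int, 0 <= w <= r%:Z & u%:Z * r%:Z + w * p%:Z = p%:Z * r%:Z + 1.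
Proof.
move=> p1 up; rewrite (modn_small p1) => e.
have := divn_eq (u * r) p; rewrite e; set k := (_ %/ _)%N => ur.
exists (r%:Z - k%:Z); first by nia.
by rewrite -PoszM ur PoszD PoszM; ring.
Qed.

(** The interval [[0, w)] has spread [w - 1], and [w p = (p - v) q + 1]. *)
Lemma spread_below (p : nat) (q v w y y' : int) :
  v * q + w * p%:Z = p%:Z * q + 1 -> 0 <= y -> y' < w ->
  (y' - y) * p%:Z <= (p%:Z - v) * q - (p%:Z - 1).
Proof.
move=> e y0 yw; have : (y' - y) * p%:Z <= (w - 1) * p%:Z by rewrite ler_wpM2r //; lia.
by lia.
Qed.

(** The complementary interval [[w, q)] satisfies [(q - w) p = v q - 1]. *)
Lemma spread_above (p : nat) (q v w y y' : int) :
  v * q + w * p%:Z = p%:Z * q + 1 -> w <= y -> y' < q ->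
  (y' - y) * p%:Z <= v * q - (p%:Z - 1).
Proof.
move=> e wy yq; have : (y' - y) * p%:Z <= (q - 1 - w) * p%:Z by rewrite ler_wpM2r //; lia.
by lia.
Qed.

Section TernaryCoef.
Variables p q r n u v : nat.
Hypotheses (p_pr : prime p) (q_pr : prime q) (r_pr : prime r).
Hypotheses (q_neq_r : q != r) (p_lt_q : (p < q)%N) (p_lt_r : (p < r)%N).
Hypotheses (ur : (u * r = 1 %[mod p])%N) (vq : (v * q = 1 %[mod p])%N).
Hypothesis n_lt : (n < p * q * r)%N.

Let p1 : (1 < p)%N. Proof. exact: prime_gt1. Qed.
Let q0 : (0 < q)%N. Proof. exact: prime_gt0. Qed.
Let r0 : (0 < r)%N. Proof. exact: prime_gt0. Qed.
Let pq : coprime p q. Proof. by rewrite prime_coprime // dvdn_prime2 // ltn_eqF. Qed.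
Let pr : coprime p r. Proof. by rewrite prime_coprime // dvdn_prime2 // ltn_eqF. Qed.
Let qr : coprime q r. Proof. by rewrite prime_coprime // dvdn_prime2. Qed.

Lemma acoef_chi_diff : acoef p q r n = \sum_(i < p) chi_diff p q r (n%:Z - i%:Z).
Proof.
rewrite /acoef Cyclotomic_ternary_coef //; first by rewrite ltn_eqF.
by rewrite ltn_eqF.
Qed.

Let m_lt (i : 'I_p) : n%:Z - i%:Z < p%:Z * q%:Z * r%:Z.
Proof. by move: n_lt; rewrite -ltz_nat !PoszM; lia. Qed.

(** This lower bound keeps [F] at most 2 at all four arguments of every summand. *)
Let m_gt (i : 'I_p) : - (q%:Z * r%:Z + p%:Z * r%:Z + p%:Z * q%:Z) < n%:Z - i%:Z - q%:Z - r%:Z.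
Proof.
have h1 : 0 <= (r%:Z - 2) * q%:Z by rewrite mulr_ge0 //; lia.
have h2 : 0 <= (p%:Z - 2) * r%:Z by rewrite mulr_ge0 //; lia.
have h3 : 0 < p%:Z * q%:Z by rewrite mulr_gt0 //; lia.
by have := ltn_ord i; lia.
Qed.

(** Here [u] and [v] play the roles of [alpha] and [beta]. In [b1] and [b3] the exceptional indices
    are counted by their interval of [x]; in [b2] and [b4] by the intervals confining [y] and [z] at
    a fixed [F]. *)
Lemma acoef_bound_small : (0 < u <= v)%N -> (u + v <= p)%N ->
  acoef p q r n <= Num.min (2 * u + v)%:Z (p - v)%:Z /\
  - acoef p q r n <= Num.min (p + 2 * u - v)%:Z v%:Z.
Proof.
move=> uv uvp.
have [w hw uw] := modn_inv_complement p1 (ltac:(lia) : (u <= p)%N) ur.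
have [w' hw' vw] := modn_inv_complement p1 (ltac:(lia) : (v <= p)%N) vq.
have [x [y [z [F [x_inj rep]]]]] := crt_rep_window n (ltnW p1) q0 r0 pq pr qr.
have hu : 0 <= u%:Z <= p%:Z by lia.
have hv : 0 <= v%:Z <= p%:Z by lia.
have uv' : 0 < u%:Z <= v%:Z by lia.
have uvp' : u%:Z + v%:Z <= p%:Z by lia.
have le i := chi_diff_le_small pq pr qr hu hv hw hw' uw vw (@m_lt i) (@m_gt i) (rep i) uv' uvp'.
have ge i := chi_diff_ge_small pq pr qr hu hv hw hw' uw vw (@m_lt i) (@m_gt i) (rep i) uv' uvp'.
have mm (i j : 'I_p) : (n%:Z - i%:Z) - (n%:Z - j%:Z) <= p%:Z - 1 by have := ltn_ord j; lia.
rewrite acoef_chi_diff -sumrN !le_min.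
have b1 : \sum_(i < p) chi_diff p q r (n%:Z - i%:Z) <= u%:Z + (p%:Z - u%:Z - v%:Z).
  by apply: (sum_le_spread x_inj _ _ le); lia.
have b2 : \sum_(i < p) chi_diff p q r (n%:Z - i%:Z) <= u%:Z + (u%:Z + v%:Z).
  apply: (sum_le_spread x_inj _ _ le); [lia|lia|lia|].
  move=> i j /and4P[_ /eqP Fi wy wz] /and4P[_ /eqP Fj wy' wz'].
  have := rep i; have := rep j; rewrite Fi Fj => repj repi.
  have [_ /andP[y0 _] /andP[z0 _] _] := repi; have [_ /andP[_ yq] /andP[_ zr] _] := repj.
  exact: crt_rep_spread p1 q0 r0 repi repj (mm i j)
    (spread_above vw wy yq) (spread_above uw wz zr).
have b3 : \sum_(i < p) - chi_diff p q r (n%:Z - i%:Z) <= u%:Z + (v%:Z - u%:Z).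
  by apply: (sum_le_spread x_inj _ _ ge); lia.
have b4 : \sum_(i < p) - chi_diff p q r (n%:Z - i%:Z) <= u%:Z + (u%:Z + (p%:Z - v%:Z)).
  apply: (sum_le_spread x_inj _ _ ge); [lia|lia|lia|].
  move=> i j /and4P[_ /eqP Fi wy wz] /and4P[_ /eqP Fj wy' wz'].
  have := rep i; have := rep j; rewrite Fi Fj => repj repi.
  have [_ /andP[y0 _] /andP[z0 _] _] := repi; have [_ /andP[_ yq] /andP[_ zr] _] := repj.
  exact: crt_rep_spread p1 q0 r0 repi repj (mm i j)
    (spread_below vw y0 wy') (spread_above uw wz zr).
by split; apply/andP; split;
  [apply: le_trans b2 _ | apply: le_trans b1 _ | apply: le_trans b4 _ | apply: le_trans b3 _]; lia.
Qed.

(** Now [p - u] and [p - v] play the roles of [alpha] and [beta]. *)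
Lemma acoef_bound_large : (v <= u < p)%N -> (p <= u + v)%N ->
  acoef p q r n <= Num.min (2 * (p - u) + (p - v))%:Z v%:Z /\
  - acoef p q r n <= Num.min (p + 2 * (p - u) - (p - v))%:Z (p - v)%:Z.
Proof.
move=> uv uvp.
have [w hw uw] := modn_inv_complement p1 (ltac:(lia) : (u <= p)%N) ur.
have [w' hw' vw] := modn_inv_complement p1 (ltac:(lia) : (v <= p)%N) vq.
have [x [y [z [F [x_inj rep]]]]] := crt_rep_window n (ltnW p1) q0 r0 pq pr qr.
have hu : 0 <= u%:Z <= p%:Z by lia.
have hv : 0 <= v%:Z <= p%:Z by lia.
have uv' : v%:Z <= u%:Z < p%:Z by lia.
have uvp' : p%:Z <= u%:Z + v%:Z by lia.
have le i := chi_diff_le_large pq pr qr hu hv hw hw' uw vw (@m_lt i) (@m_gt i) (rep i) uv' uvp'.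
have ge i := chi_diff_ge_large pq pr qr hu hv hw hw' uw vw (@m_lt i) (@m_gt i) (rep i) uv' uvp'.
have mm (i j : 'I_p) : (n%:Z - i%:Z) - (n%:Z - j%:Z) <= p%:Z - 1 by have := ltn_ord j; lia.
rewrite acoef_chi_diff -sumrN !le_min.
have b1 : \sum_(i < p) chi_diff p q r (n%:Z - i%:Z) <= (p%:Z - u%:Z) + (u%:Z + v%:Z - p%:Z).
  by apply: (sum_le_spread x_inj _ _ le); lia.
have b2 : \sum_(i < p) chi_diff p q r (n%:Z - i%:Z)
    <= (p%:Z - u%:Z) + ((p%:Z - u%:Z) + (p%:Z - v%:Z)).
  apply: (sum_le_spread x_inj _ _ le); [lia|lia|lia|].
  move=> i j /and4P[_ /eqP Fi wy wz] /and4P[_ /eqP Fj wy' wz'].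
  have := rep i; have := rep j; rewrite Fi Fj => repj repi.
  have [_ /andP[y0 _] /andP[z0 _] _] := repi; have [_ /andP[_ yq] /andP[_ zr] _] := repj.
  exact: crt_rep_spread p1 q0 r0 repi repj (mm i j)
    (spread_below vw y0 wy') (spread_below uw z0 wz').
have b3 : \sum_(i < p) - chi_diff p q r (n%:Z - i%:Z) <= (p%:Z - u%:Z) + (u%:Z - v%:Z).
  by apply: (sum_le_spread x_inj _ _ ge); lia.
have b4 : \sum_(i < p) - chi_diff p q r (n%:Z - i%:Z) <= (p%:Z - u%:Z) + ((p%:Z - u%:Z) + v%:Z).
  apply: (sum_le_spread x_inj _ _ ge); [lia|lia|lia|].
  move=> i j /and4P[_ /eqP Fi wy wz] /and4P[_ /eqP Fj wy' wz'].
  have := rep i; have := rep j; rewrite Fi Fj => repj repi.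
  have [_ /andP[y0 _] /andP[z0 _] _] := repi; have [_ /andP[_ yq] /andP[_ zr] _] := repj.
  exact: crt_rep_spread p1 q0 r0 repi repj (mm i j)
    (spread_above vw wy yq) (spread_below uw z0 wz').
by split; apply/andP; split;
  [apply: le_trans b2 _ | apply: le_trans b1 _ | apply: le_trans b4 _ | apply: le_trans b3 _]; lia.
Qed.

End TernaryCoef.

(** * Identification of [beta] modulo [p] *)

Lemma eqn_mod_dvdz (p a : nat) : (a = 1 %[mod p])%N -> (p %| a%:Z - 1)%Z.
Proof. by move=> e; rewrite -eqz_mod_dvd !modz_nat e. Qed.

(** Since [s a q] and [a b q r] are both 1 modulo [p], so is [s b r]. The sign [s] covers
    [alpha = q'] and [alpha = p - q'] together. *)
Lemma inv_mul_cancel (p q r r' b : nat) (a s : int) :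
  coprime p r -> s * s = 1 -> (p %| s * a * q%:Z - 1)%Z -> (p %| a * b%:Z * q%:Z * r%:Z - 1)%Z ->
  (r * r' = 1 %[mod p])%N -> (p %| s * b%:Z - r'%:Z)%Z.
Proof.
move=> pr ss dq dab /eqn_mod_dvdz dr.
have cpr : coprimez p r by [].
rewrite -(Gauss_dvdzl _ cpr).
have -> : (s * b%:Z - r'%:Z) * r%:Z = (a * b%:Z * q%:Z * r%:Z - 1)
  - s * b%:Z * r%:Z * (s * a * q%:Z - 1) - ((r * r')%N%:Z - 1)
  + (s * s - 1) * (a * b%:Z * q%:Z * r%:Z) by rewrite PoszM; ring.
rewrite ss subrr mul0r addr0; apply: rpredB => //; apply: rpredB => //.
exact: dvdz_mull.
Qed.

Lemma beta_of_inv (p q r q' r' b : nat) :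
  coprime p r -> (0 < q' < p)%N -> (q * q' = 1 %[mod p])%N ->
  (0 < r' < p)%N -> (r * r' = 1 %[mod p])%N -> (0 < b < p)%N ->
  ((q' * b * q * r = 1 %[mod p])%N -> b = r') /\
  (((p - q') * b * q * r = 1 %[mod p])%N -> b = (p - r')%N).
Proof.
move=> pr hq' /eqn_mod_dvdz; rewrite PoszM mulrC => dq hr' dr hb.
split=> /eqn_mod_dvdz; rewrite !PoszM => dab.
  suff : b%:Z = r'%:Z by case.
  apply: (@modz_eq_small p); [lia|lia|].
  by have := @inv_mul_cancel p q r r' b q'%:Z 1 pr erefl; rewrite !mul1r; apply.
have /dvdzP[k e] : (p %| -1 * b%:Z - r'%:Z)%Z.
  apply: (@inv_mul_cancel p q r r' b (p - q')%N%:Z (-1) pr erefl) => //.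
  have -> : -1 * (p - q')%N%:Z * q%:Z - 1 = (q'%:Z * q%:Z - 1) + (- q%:Z) * p%:Z.
    by rewrite -subzn; [ring | lia].
  by rewrite rpredD // dvdz_mull.
have p0 : 0 < p%:Z by case/andP: hb => _; exact: leq_ltn_trans.
(* The multiple [k p = -b - r'] lies strictly between [-2p] and 0. *)
have k_lt0 : k < 0 by rewrite -(pmulr_llt0 _ p0) -e; lia.
have k_gtN2 : -2 < k by rewrite -(ltr_pM2r p0) -e; lia.
have ek : k = -1 by lia.
by rewrite ek in e; lia.
Qed.

(** * Choice of case and passage to the extreme coefficients *)

Lemma acoefC (p q r n : nat) : acoef p q r n = acoef p r q n.
Proof. by rewrite /acoef mulnAC. Qed.

Lemma min4_cases (p a b : nat) : (a < p)%N -> (b < p)%N ->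
  let alpha := minn (minn a b) (minn (p - a) (p - b)) in
  alpha = a /\ (a <= b)%N && (a + b <= p)%N \/
  alpha = b /\ (b <= a)%N && (a + b <= p)%N \/
  alpha = (p - a)%N /\ (b <= a)%N && (p <= a + b)%N \/
  alpha = (p - b)%N /\ (a <= b)%N && (p <= a + b)%N.
Proof. by move=> ap bp; rewrite /=; lia. Qed.

Lemma acoef_bound (p q r q' r' beta n : nat) :
  prime p -> prime q -> prime r -> q != r -> (p < q)%N -> (p < r)%N ->
  (0 < q' < p)%N -> (q * q' = 1 %[mod p])%N ->
  (0 < r' < p)%N -> (r * r' = 1 %[mod p])%N ->
  let alpha := minn (minn q' r') (minn (p - q') (p - r')) in
  (0 < beta < p)%N -> (alpha * beta * q * r = 1 %[mod p])%N -> (n < p * q * r)%N ->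
  acoef p q r n <= Num.min (2 * alpha + beta)%:Z (p - beta)%:Z /\
  - acoef p q r n <= Num.min (p + 2 * alpha - beta)%:Z beta%:Z.
Proof.
move=> p_pr q_pr r_pr qr p_lt_q p_lt_r hq' eq' hr' er' alpha hb eb n_lt.
have pq : coprime p q by rewrite prime_coprime // dvdn_prime2 // ltn_eqF.
have pr : coprime p r by rewrite prime_coprime // dvdn_prime2 // ltn_eqF.
have n_lt' : (n < p * r * q)%N by rewrite mulnAC.
have rq : r != q by rewrite eq_sym.
have vq : (q' * q = 1 %[mod p])%N by rewrite mulnC.
have ur : (r' * r = 1 %[mod p])%N by rewrite mulnC.
have [bq bpq] := beta_of_inv pr hq' eq' hr' er' hb.
have [br bpr] := beta_of_inv pq hr' er' hq' eq' hb.
have ebr : (alpha * beta * r * q = 1 %[mod p])%N by rewrite mulnAC.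
have /andP[q'0 q'p] := hq'; have /andP[r'0 r'p] := hr'.
have [[aE /andP[h1 h2]] | [[aE /andP[h1 h2]] | [[aE /andP[h1 h2]] | [aE /andP[h1 h2]]]]] :=
  min4_cases q'p r'p; rewrite -/alpha in aE.
(* The section takes [u] inverse to its third prime, so [q] and [r] are swapped when [alpha] comes
   from [q']. *)
- rewrite aE in eb *; rewrite (bq eb) acoefC.
  by apply: acoef_bound_small => //; rewrite q'0.
- rewrite aE in ebr *; rewrite (br ebr).
  by apply: acoef_bound_small => //; rewrite ?r'0 // addnC.
- rewrite aE in eb *; rewrite (bpq eb) acoefC (subKn (ltnW r'p)).
  by apply: acoef_bound_large => //; rewrite h1.
rewrite aE in ebr *; rewrite (bpr ebr) (subKn (ltnW q'p)).
by apply: acoef_bound_large => //; rewrite ?h1 // addnC.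
Qed.

(** The degree stays below [pqr], so the coefficient formula reaches every coefficient. *)
Lemma ltn_totient_ternary (p q r : nat) :
  prime p -> prime q -> prime r -> p != q -> p != r -> q != r ->
  (totient (p * q * r) < p * q * r)%N.
Proof.
move=> p_pr q_pr r_pr pq pr qr.
have [[p0 q0] r0] := (prime_gt1 p_pr, prime_gt0 q_pr, prime_gt0 r_pr).
rewrite totient_coprime; last first.
  by rewrite coprimeMl !prime_coprime // !dvdn_prime2 // pr.
rewrite totient_coprime ?prime_coprime ?dvdn_prime2 // !totient_prime //.
apply: (@leq_ltn_trans (p.-1 * q * r)); first by rewrite !leq_mul ?leq_pred.
by rewrite !ltn_pmul2r // prednK // ltnW.
Qed.

Theorem theorem1 (p q r q' r' beta : nat) :
  prime p -> prime q -> prime r -> q != r -> (p < q)%N -> (p < r)%N ->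
  (0 < q' < p)%N -> (q * q' = 1 %[mod p])%N ->
  (0 < r' < p)%N -> (r * r' = 1 %[mod p])%N ->
  let alpha := minn (minn q' r') (minn (p - q') (p - r')) in
  (0 < beta < p)%N -> (alpha * beta * q * r = 1 %[mod p])%N ->
  Aplus p q r <= Num.min (2 * alpha + beta)%:Z (p - beta)%:Z /\
  - Aminus p q r <= Num.min (p + 2 * alpha - beta)%:Z beta%:Z.
Proof.
move=> p_pr q_pr r_pr qr p_lt_q p_lt_r hq' eq' hr' er' alpha hb eb.
have n_lt (n : 'I_(size 'Phi_(p * q * r))) : (n < p * q * r)%N.
  apply: leq_ltn_trans (@ltn_totient_ternary p q r _ _ _ _ _ _) => //; rewrite ?ltn_eqF //.
  by rewrite -ltnS -size_Cyclotomic.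
have bound n := acoef_bound p_pr q_pr r_pr qr p_lt_q p_lt_r hq' eq' hr' er' hb eb (n_lt n).
split.
  (* The initial value 0 of the maximum must also obey the bound. *)
  by apply: bigmax_le => [|n _]; [rewrite le_min | have [] := bound n].
rewrite lerNl; apply: le_bigmin => [|n _]; first by rewrite oppr_le0 le_min.
by rewrite lerNl; have [] := bound n.
Qed.
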